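(* Let $S=(S_{ij})_{i,j=1}^r$ be a real symmetric matrix with $S_{ii}\ge 0$ for all $i$, and suppose that \[ S_{ij}\ge-\theta\sqrt{S_{ii}S_{jj}}\qquad(i\ne j) \] for some $\theta\ge 0$. For $c\in\mathbb R_{\ge0}^r$, put $x_i=c_i\sqrt{S_{ii}}$ and $\varepsilon_{ij}=S_{ij}+\theta\sqrt{S_{ii}S_{jj}}\ge 0$ for $i\neq j$. Then \[ c^{\mathsf T}Sc=\bigl(1-(r-1)\theta\bigr)\sum_{i=1}^r x_i^2+\theta\sum_{i<j}(x_i-x_j)^2+2\sum_{i<j}c_ic_j\varepsilon_{ij}. \] In particular, $S$ is copositive whenever $\theta\le 1/(r-1)$ (i.e. $(r-1)\theta\le 1$).
   Context: A real symmetric matrix $S$ is copositive if $c^{\mathsf T}Sc\ge0$ for every vector $c$ with nonnegative entries. *)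

(* Defs.v *)
From mathcomp Require Import all_boot all_order all_algebra.
Import Order.TTheory GRing.Theory Num.Theory.
Set Implicit Arguments. Unset Strict Implicit. Unset Printing Implicit Defensive.
Local Open Scope ring_scope.

Definition copositive (R : rcfType) (r : nat) (S : 'M[R]_r) : Prop :=
  S^T = S /\
  forall c : 'cV[R]_r, (forall i, 0 <= c i 0) -> 0 <= (c^T *m S *m c) 0 0.

(* Main.v *)
(* With x_i x_j = c_i c_j sqrt (S_ii S_jj), the form is the sum of x_i^2 plus
   twice the sum over i < j of c_i c_j eps_ij - theta x_i x_j, and Lagrange's
   identity turns the cross terms into squares of differences.  Every term is
   then nonnegative as soon as (r - 1) theta <= 1. *)
Require Import Defs.
From mathcomp Require Import all_boot all_order all_algebra.
From mathcomp Require Import ring.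
Import Order.TTheory GRing.Theory Num.Theory.
Set Implicit Arguments. Unset Strict Implicit. Unset Printing Implicit Defensive.
Local Open Scope ring_scope.

(** Once the diagonal is split off, exchanging the order of summation and using symmetry turns the
    part [j < i] into a second copy of the part [i < j]. *)
Lemma sum_sym_pairs (V : nmodType) (r : nat) (F : 'I_r -> 'I_r -> V) :
  (forall i j, F i j = F j i) ->
  \sum_(i < r) \sum_(j < r) F i j =
    \sum_(i < r) F i i + (\sum_(i < r) \sum_(j < r | (i < j)%N) F i j) *+ 2.
Proof.
move=> symF; rewrite mulr2n.
have -> : \sum_(i < r) \sum_(j < r) F i j = \sum_(i < r) (F i i +
    (\sum_(j < r | (i < j)%N) F i j + \sum_(j < r | (j < i)%N) F i j)).
  apply: eq_bigr => i _; rewrite (bigD1 i) //=; congr (_ + _).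
  rewrite (bigID (fun j : 'I_r => (i < j)%N)) /=.
  by congr (_ + _); apply: eq_bigl => j; rewrite -(inj_eq val_inj) /=; case: ltngtP.
rewrite !big_split /=; congr (_ + (_ + _)).
rewrite (exchange_big_dep xpredT) //=.
by apply: eq_bigr => i _; apply: eq_bigr => j _; rewrite symF.
Qed.

(** Apply [sum_sym_pairs] to [x i ^+ 2 + x j ^+ 2]: the full double sum is [2 * r] times the sum of
    squares and the diagonal is twice that sum, so the pairs contribute [r - 1] times it. *)
Lemma sum_sqr_sub_pairs (R : numDomainType) (r : nat) (x : 'I_r -> R) :
  \sum_(i < r) \sum_(j < r | (i < j)%N) (x i - x j) ^+ 2 =
    (r%:R - 1) * (\sum_(i < r) x i ^+ 2)
    - 2 * (\sum_(i < r) \sum_(j < r | (i < j)%N) x i * x j).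
Proof.
have := @sum_sym_pairs R r (fun i j => x i ^+ 2 + x j ^+ 2)
  (fun i j => addrC _ _).
have -> : \sum_(i < r) \sum_(j < r) (x i ^+ 2 + x j ^+ 2) =
    2 * (r%:R * \sum_(i < r) x i ^+ 2).
  under eq_bigr do rewrite big_split /= sumr_const card_ord.
  rewrite big_split /= sumr_const card_ord -sumrMnl mulr_natl -mulr_natl.
  by rewrite sumrMnl -mulr_natl; ring.
rewrite big_split /= => sumE.
have -> : \sum_(i < r) \sum_(j < r | (i < j)%N) (x i - x j) ^+ 2 =
    \sum_(i < r) \sum_(j < r | (i < j)%N) (x i ^+ 2 + x j ^+ 2)
    - 2 * (\sum_(i < r) \sum_(j < r | (i < j)%N) x i * x j).
  rewrite mulr_sumr -sumrB; apply: eq_bigr => i _.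
  by rewrite mulr_sumr -sumrB; apply: eq_bigr => j _; ring.
(* Doubling both sides makes the sum over pairs appear as in [sumE], with no division in [R]. *)
congr (_ - _); apply: (mulfI (x := 2)); first by rewrite pnatr_eq0.
rewrite mulr_natl -[LHS](addKr (\sum_(i < r) x i ^+ 2 + \sum_(i < r) x i ^+ 2)).
by rewrite -sumE; ring.
Qed.

(** Symmetry of [S] makes [c i 0 * c j 0 * S i j] symmetric in [i] and [j], so [sum_sym_pairs]
    applies. *)
Lemma mx_quad_form_pairs (R : comPzRingType) (r : nat) (S : 'M[R]_r)
    (c : 'cV[R]_r) : S^T = S ->
  (c^T *m S *m c) 0 0 = \sum_(i < r) c i 0 ^+ 2 * S i i
    + 2 * (\sum_(i < r) \sum_(j < r | (i < j)%N) c i 0 * c j 0 * S i j).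
Proof.
move=> S_sym.
have symS i j : S i j = S j i by rewrite -[in LHS]S_sym mxE.
have := @sum_sym_pairs R r (fun i j => c i 0 * c j 0 * S i j).
rewrite mulr_natl => <-; last by move=> i j; rewrite symS (mulrC (c i 0)).
rewrite -mulmxA mxE; apply: eq_bigr => i _; rewrite !mxE mulr_sumr.
by apply: eq_bigr => j _; rewrite mulrCA mulrC -mulrA mulrC.
Qed.

Theorem lemma5p1 (R : rcfType) (r : nat) (S : 'M[R]_r) (theta : R)
  (S_sym : S^T = S)
  (S_diag : forall i, 0 <= S i i)
  (theta_ge0 : 0 <= theta)
  (S_offdiag : forall i j, i != j ->
     - theta * Num.sqrt (S i i * S j j) <= S i j) :
  let eps (i j : 'I_r) := S i j + theta * Num.sqrt (S i i * S j j) in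
  [/\ forall i j, i != j -> 0 <= eps i j,
      forall c : 'cV[R]_r, (forall i, 0 <= c i 0) ->
        let x (i : 'I_r) := c i 0 * Num.sqrt (S i i) in
        (c^T *m S *m c) 0 0 =
          (1 - (r%:R - 1) * theta) * (\sum_(i < r) x i ^+ 2)
          + theta * (\sum_(i < r) \sum_(j < r | (i < j)%N) (x i - x j) ^+ 2)
          + 2 * (\sum_(i < r) \sum_(j < r | (i < j)%N) c i 0 * c j 0 * eps i j)
    & (r%:R - 1) * theta <= 1 -> copositive S].
Proof.
move=> eps.
have eps_ge0 i j : i != j -> 0 <= eps i j.
  by move=> /S_offdiag; rewrite mulNr -subr_ge0 opprK.
have quadE (c : 'cV[R]_r) (x := fun i => c i 0 * Num.sqrt (S i i)) :
    (c^T *m S *m c) 0 0 =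
      (1 - (r%:R - 1) * theta) * (\sum_(i < r) x i ^+ 2)
      + theta * (\sum_(i < r) \sum_(j < r | (i < j)%N) (x i - x j) ^+ 2)
      + 2 * (\sum_(i < r) \sum_(j < r | (i < j)%N) c i 0 * c j 0 * eps i j).
  have xxE : \sum_(i < r) c i 0 ^+ 2 * S i i = \sum_(i < r) x i ^+ 2.
    by apply: eq_bigr => i _; rewrite exprMn sqr_sqrtr.
  have epsE : \sum_(i < r) \sum_(j < r | (i < j)%N) c i 0 * c j 0 * eps i j =
      \sum_(i < r) \sum_(j < r | (i < j)%N) c i 0 * c j 0 * S i j
      + theta * (\sum_(i < r) \sum_(j < r | (i < j)%N) x i * x j).
    rewrite mulr_sumr -big_split; apply: eq_bigr => i _ /=.
    rewrite mulr_sumr -big_split; apply: eq_bigr => j _ /=.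
    (* Since [S i i] is nonnegative, the root of the product splits, and the [theta] term of
       [eps i j] contributes [theta * (x i * x j)]. *)
    by rewrite /eps /x sqrtrM //; ring.
  (* The products [x i * x j] from the squared differences cancel those from [eps], and the
     multiples of [(r - 1) * theta] cancel as well. *)
  by rewrite mx_quad_form_pairs // xxE epsE sum_sqr_sub_pairs; ring.
split=> // theta_le; split=> // c c_ge0; rewrite quadE.
(* The bound [theta_le] is exactly nonnegativity of the first coefficient; only the three sums
   remain. *)
rewrite !addr_ge0 ?mulr_ge0 ?subr_ge0 ?sumr_ge0 // => i _.
- by rewrite sqr_ge0.
- by rewrite sumr_ge0 // => j _; rewrite sqr_ge0.
rewrite sumr_ge0 // => j lt_ij; rewrite !mulr_ge0 //.
by rewrite eps_ge0 // -(inj_eq val_inj) neq_ltn lt_ij.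
Qed.
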